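(* Let $X$ be a regular Banach space. Then every bounded trilinear map $f:X\times X\times X\to X$ is Aron--Berner regular.
   Context: A Banach space $X$ is called regular if every bounded linear map from $X$ into $X^*$ is weakly compact. Every Banach space is identified with its canonical image in its bidual. For a bounded trilinear map $f:X_1\times X_2\times X_3\to Y$ between Banach spaces, the adjoint $f^*:Y^*\times X_1\times X_2\to X_3^*$ is given by $\langle f^*(y^*,x_1,x_2),x_3\rangle=\langle y^*,f(x_1,x_2,x_3)\rangle$. Iterating, $f^{**}=(f^* )^*$, $f^{***}=(f^{**})^*$, and $f^{\circledast}:=f^{****}:X_1^{**}\times X_2^{**}\times X_3^{**}\to Y^{**}$, a norm preserving trilinear extension of $f$. For $\sigma\in S_3$ (permutations of $\{1,2,3\}$), let $f^\sigma:X_{\sigma(1)}\times X_{\sigma(2)}\times X_{\sigma(3)}\to Y$, $f^\sigma(x_{\sigma(1)},x_{\sigma(2)},x_{\sigma(3)})=f(x_1,x_2,x_3)$, and let $f^{\sigma\circledast\sigma^{-1}}(x_1^{**},x_2^{**},x_3^{**})=(f^\sigma)^{\circledast}(x_{\sigma(1)}^{**},x_{\sigma(2)}^{**},x_{\sigma(3)}^{**})$. The map $f$ is called Aron--Berner regular if these six extensions coincide, i.e. $f^{\sigma\circledast\sigma^{-1}}=f^{\circledast}$ for every $\sigma\in S_3$. *)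

(* Defs.v *)
From HB Require Import structures.
From mathcomp Require Import all_boot all_order all_algebra fingroup perm.
From mathcomp Require Import all_classical all_reals all_analysis.
From mathcomp Require Import complex ring.

Set Implicit Arguments.
Unset Strict Implicit.
Unset Printing Implicit Defensive.

Import Order.TTheory GRing.Theory Num.Theory.
Import numFieldNormedType.Exports.

Local Open Scope classical_set_scope.
Local Open Scope ring_scope.

(** Banach spaces are real or complex: [scalars R k] is the real field [R] or
    the complex field [R[i]].  Norms on a [normedModType K] are [K]-valued, so
    over [R[i]] they take values among the nonnegative reals of [R[i]]. *)
Variant scalar_kind := RealScalars | ComplexScalars.

Definition scalars (R : realType) (k : scalar_kind) : numFieldType :=
  match k with
  | RealScalars => R
  | ComplexScalars => (R[i])%C
  end.

Lemma scalars_supremums (R : realType) (k : scalar_kind)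
    (A : set (scalars R k)) (M : scalars R k) :
  A !=set0 -> (forall x, A x -> 0 <= x) -> ubound A M -> supremums A !=set0.
Proof.
case: k A M => /= A M A0 Age AM.
  exists (sup A); split.
    by apply/ubP => x Ax; apply: ub_le_sup => //; exists M.
  by apply/lbP => y Ay; apply: ge_sup.
pose B : set R := [set complex.Re x | x in A].
have B0 : B !=set0 by case: A0 => a Aa; exists (complex.Re a); exists a.
have BM : ubound B (complex.Re M).
  apply/ubP => _ [x Ax <-]; have /ubP/(_ _ Ax) := AM.
  by rewrite lecE => /andP[].
have ReA x : A x -> (real_complex R (complex.Re x)) = x.
  by move=> Ax; apply: RRe_real; apply: ger0_real; exact: Age.
exists (real_complex R (sup B)); split.
  apply/ubP => x Ax; rewrite -(ReA _ Ax) lecR.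
  by apply: ub_le_sup; [exists (complex.Re M)|exists x].
apply/lbP => y Ay.
have yr : real_complex R (complex.Re y) = y.
  case: A0 => a Aa; apply: RRe_real; apply: ger0_real.
  by apply: (le_trans (Age _ Aa)); move/ubP: Ay; exact.
rewrite -yr lecR; apply: ge_sup => // _ [x Ax <-].
by move/ubP/(_ _ Ax): Ay; rewrite lecE => /andP[].
Qed.

Definition bounded_map (K : numFieldType) (X Y : normedModType K)
    (T : X -> Y) : Prop :=
  exists M : K, forall x, `|T x| <= M * `|x|.

Section DualLmodule.
Context {K : numFieldType} (X : normedModType K).

Record dual := Dual {
  dual_fun :> X -> K^o;
  dual_linear : linear dual_fun;
  dual_bounded : bounded_map dual_fun }.

HB.instance Definition _ (phi : dual) :=
  GRing.isLinear.Build K X K^o *:%R (dual_fun phi) (dual_linear phi).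

Lemma dual_ext (phi psi : dual) : (forall x, phi x = psi x) -> phi = psi.
Proof.
case: phi psi => f fl fb [g gl gb] /= /funext fg.
by case: _ / fg gl gb => gl gb; congr Dual; exact: Prop_irrelevance.
Qed.

Lemma zero_dual_linear : linear (fun _ : X => 0 : K^o).
Proof. by move=> a x y; rewrite scaler0 addr0. Qed.

Lemma zero_dual_bounded : bounded_map (fun _ : X => 0 : K^o).
Proof. by exists 0 => x; rewrite normr0 mul0r. Qed.

Definition zero_dual := Dual zero_dual_linear zero_dual_bounded.

Lemma opp_dual_linear (phi : dual) : linear (fun x => - phi x).
Proof. by move=> a x y; rewrite linearP opprD scalerN. Qed.

Lemma opp_dual_bounded (phi : dual) : bounded_map (fun x => - phi x).
Proof. by have [M hM] := dual_bounded phi; exists M => x; rewrite normrN. Qed.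

Definition opp_dual (phi : dual) :=
  Dual (opp_dual_linear phi) (opp_dual_bounded phi).

Lemma add_dual_linear (phi psi : dual) : linear (fun x => phi x + psi x).
Proof. by move=> a x y; rewrite !linearP scalerDr addrACA. Qed.

Lemma add_dual_bounded (phi psi : dual) : bounded_map (fun x => phi x + psi x).
Proof.
have [M hM] := dual_bounded phi; have [N hN] := dual_bounded psi.
by exists (M + N) => x; rewrite mulrDl (le_trans (ler_normD _ _)) ?lerD.
Qed.

Definition add_dual (phi psi : dual) :=
  Dual (add_dual_linear phi psi) (add_dual_bounded phi psi).

Lemma scale_dual_linear (a : K) (phi : dual) : linear (fun x => a *: phi x).
Proof. by move=> b x y; rewrite linearP scalerDr !scalerA mulrC. Qed.

Lemma scale_dual_bounded (a : K) (phi : dual) :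
  bounded_map (fun x => a *: phi x).
Proof.
have [M hM] := dual_bounded phi; exists (`|a| * M) => x.
by rewrite normrZ -mulrA ler_wpM2l.
Qed.

Definition scale_dual (a : K) (phi : dual) :=
  Dual (scale_dual_linear a phi) (scale_dual_bounded a phi).

HB.instance Definition _ := gen_eqMixin dual.
HB.instance Definition _ := gen_choiceMixin dual.

Fact add_dualA : associative add_dual.
Proof. by move=> f g h; apply: dual_ext => x /=; rewrite addrA. Qed.
Fact add_dualC : commutative add_dual.
Proof. by move=> f g; apply: dual_ext => x /=; rewrite addrC. Qed.
Fact add_dual0 : left_id zero_dual add_dual.
Proof. by move=> f; apply: dual_ext => x /=; rewrite add0r. Qed.
Fact add_dualN : left_inverse zero_dual opp_dual add_dual.
Proof. by move=> f; apply: dual_ext => x /=; rewrite addNr. Qed.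

HB.instance Definition _ :=
  GRing.isZmodule.Build dual add_dualA add_dualC add_dual0 add_dualN.

Fact scale_dualA (a b : K) (f : dual) :
  scale_dual a (scale_dual b f) = scale_dual (a * b) f.
Proof. by apply: dual_ext => x /=; rewrite scalerA. Qed.
Fact scale_dual1 : left_id 1 scale_dual.
Proof. by move=> f; apply: dual_ext => x /=; rewrite scale1r. Qed.
Fact scale_dualDr : right_distributive scale_dual +%R.
Proof. by move=> a f g; apply: dual_ext => x /=; rewrite scalerDr. Qed.
Fact scale_dualDl (f : dual) : {morph scale_dual^~ f : a b / a + b}.
Proof. by move=> a b; apply: dual_ext => x /=; rewrite scalerDl. Qed.

HB.instance Definition _ :=
  GRing.Zmodule_isLmodule.Build K dual
    scale_dualA scale_dual1 scale_dualDr scale_dualDl.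

(** The supremum is taken in [K], for the order of [K]; it exists whenever [K]
    is one of the [scalars], see [dual_norm_lub]. *)
Definition dual_norm (phi : dual) : K :=
  supremum 0 [set `|phi x| | x in [set x : X | `|x| <= 1]].

End DualLmodule.

Section DualNorm.
Context (R : realType) (k : scalar_kind).
Local Notation K := (scalars R k).
Context (X : normedModType K).
Implicit Types phi psi : dual X.

Lemma dual_norm_lub phi :
  supremums [set `|phi x| | x in [set x : X | `|x| <= 1]] (dual_norm phi).
Proof.
set A := [set _ | _ in _].
have A0 : A !=set0 by exists `|phi 0|; exists 0 => //=; rewrite normr0.
have [M hM] := dual_bounded phi.
have [s sA] : supremums A !=set0.
  apply: (@scalars_supremums R k A `|M|) => //; first by move=> _ [x _ <-].
  apply/ubP => _ [x /= x1 <-]; apply: le_trans (_ : `|M| * `|x| <= _).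
    by rewrite -[X in _ * X]normr_id -normrM (le_trans (hM x))// real_ler_norm//
       ger0_real// (le_trans _ (hM x)).
  by rewrite ler_piMr.
rewrite /dual_norm /supremum ifF; last by apply/negP => /eqP; apply/eqP/set0P.
by case: xgetP => // /(_ s).
Qed.

Lemma le_dual_norm phi x : `|phi x| <= dual_norm phi * `|x|.
Proof.
have [->|x0] := eqVneq x 0; first by rewrite linear0 !normr0 mulr0.
have nx0 : 0 < `|x| by rewrite normr_gt0.
rewrite -ler_pdivrMr//.
have [/ubP + _] := dual_norm_lub phi; apply.
exists (`|x|^-1 *: x) => /=.
  by rewrite normrZ normfV normr_id mulVf// gt_eqF.
by rewrite linearZ /= normrZ normfV normr_id mulrC.
Qed.

Lemma dual_norm_le phi (M : K) :
  0 <= M -> (forall x, `|phi x| <= M * `|x|) -> dual_norm phi <= M.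
Proof.
move=> M0 hM; have [_ /lbP] := dual_norm_lub phi; apply.
apply/ubP => _ [x /= x1 <-]; apply: le_trans (hM x) _.
by rewrite ler_piMr.
Qed.

Lemma dual_norm_ge0 phi : 0 <= dual_norm phi.
Proof.
have [/ubP + _] := dual_norm_lub phi; apply.
by exists 0; rewrite /= ?linear0 normr0.
Qed.

Fact dual_normD phi psi :
  dual_norm (phi + psi) <= dual_norm phi + dual_norm psi.
Proof.
apply: dual_norm_le; first by rewrite addr_ge0 ?dual_norm_ge0.
move=> x; rewrite mulrDl (le_trans (ler_normD _ _))//.
by rewrite lerD ?le_dual_norm.
Qed.

Lemma dual_normZ_le (a : K) phi : dual_norm (a *: phi) <= `|a| * dual_norm phi.
Proof.
apply: dual_norm_le; first by rewrite mulr_ge0 ?dual_norm_ge0.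
by move=> x; rewrite normrZ -mulrA ler_wpM2l ?le_dual_norm.
Qed.

Fact dual_normZ (a : K) phi : dual_norm (a *: phi) = `|a| * dual_norm phi.
Proof.
apply/eqP; rewrite eq_le dual_normZ_le /=.
have [->|a0] := eqVneq a 0; first by rewrite normr0 mul0r dual_norm_ge0.
rewrite -ler_pdivlMl ?normr_gt0// -normfV.
by rewrite -[X in dual_norm X <= _](scalerK a0) dual_normZ_le.
Qed.

Fact dual_norm0_eq0 phi : dual_norm phi = 0 -> phi = 0.
Proof.
move=> h; apply: dual_ext => x; apply/eqP; rewrite -normr_le0.
by apply: le_trans (le_dual_norm phi x) _; rewrite h mul0r.
Qed.

HB.instance Definition _ :=
  Lmodule_isNormed.Build K (dual X) dual_normD dual_normZ dual_norm0_eq0.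

End DualNorm.

(** The weak topology on [X] is the coarsest one making every element of
    [dual X] continuous, that is, the initial topology for the evaluation map
    from [X] to the space of scalar functions on [dual X] with the topology of
    pointwise convergence. *)
Definition dual_eval (K : numFieldType) (X : normedModType K) (x : X) :
  {ptws dual X -> K^o} := fun phi => phi x.

Definition weak (K : numFieldType) (X : normedModType K) : Type :=
  initial_topology (@dual_eval K X).

HB.instance Definition _ (K : numFieldType) (X : normedModType K) :=
  Topological.copy (weak X) (initial_topology (@dual_eval K X)).

Definition weakly_compact (K : numFieldType) (X Y : normedModType K)
    (T : X -> Y) : Prop :=
  precompact (T @` [set x | `|x| <= 1] : set (weak Y)).

Definition regular_Banach (R : realType) (k : scalar_kind)
    (X : normedModType (scalars R k)) : Prop :=
  forall T : {linear X -> dual X}, bounded_map T -> weakly_compact T.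

Record bounded_trilinear (K : numFieldType) (X1 X2 X3 Y : normedModType K) :=
  BoundedTrilinear {
    trilinear_fun :> X1 -> X2 -> X3 -> Y;
    trilinear1 : forall x2 x3, linear (fun x1 => trilinear_fun x1 x2 x3);
    trilinear2 : forall x1 x3, linear (fun x2 => trilinear_fun x1 x2 x3);
    trilinear3 : forall x1 x2, linear (fun x3 => trilinear_fun x1 x2 x3);
    trilinear_bounded : exists M : K, forall x1 x2 x3,
      `|trilinear_fun x1 x2 x3| <= M * `|x1| * `|x2| * `|x3| }.

Section Adjoint.
Context (R : realType) (k : scalar_kind).
Local Notation K := (scalars R k).
Context (X1 X2 X3 Y : normedModType K) (f : bounded_trilinear X1 X2 X3 Y).

Lemma trilinear_bounded_ge0 : exists2 M : K, 0 <= M & forall x1 x2 x3,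
  `|f x1 x2 x3| <= M * `|x1| * `|x2| * `|x3|.
Proof.
have [M hM] := trilinear_bounded f; exists `|M| => // x1 x2 x3.
have h := hM x1 x2 x3; rewrite (le_trans h)// -!mulrA.
have /ger0_norm : 0 <= M * `|x1| * `|x2| * `|x3| by apply: le_trans h.
by rewrite -!mulrA => <-; rewrite !normrM !normr_id.
Qed.

Lemma adjoint_fun_linear (y : dual Y) (x1 : X1) (x2 : X2) :
  linear (fun x3 => y (f x1 x2 x3)).
Proof. by move=> a u v; rewrite trilinear3 linearP. Qed.

Lemma adjoint_fun_bounded (y : dual Y) (x1 : X1) (x2 : X2) :
  bounded_map (fun x3 => y (f x1 x2 x3)).
Proof.
have [M hM] := trilinear_bounded f.
exists (dual_norm y * (M * `|x1| * `|x2|)) => x3.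
apply: le_trans (le_dual_norm _ _) _.
by rewrite -mulrA ler_wpM2l ?dual_norm_ge0.
Qed.

Definition adjoint_fun (y : dual Y) (x1 : X1) (x2 : X2) : dual X3 :=
  Dual (adjoint_fun_linear y x1 x2) (adjoint_fun_bounded y x1 x2).

Fact adjoint_linear1 x1 x2 : linear (fun y => adjoint_fun y x1 x2).
Proof. by move=> a u v; apply: dual_ext. Qed.

Fact adjoint_linear2 y x2 : linear (fun x1 => adjoint_fun y x1 x2).
Proof.
by move=> a u v; apply: dual_ext => x3 /=; rewrite trilinear1 linearP.
Qed.

Fact adjoint_linear3 y x1 : linear (fun x2 => adjoint_fun y x1 x2).
Proof.
by move=> a u v; apply: dual_ext => x3 /=; rewrite trilinear2 linearP.
Qed.

Fact adjoint_bounded : exists M : K, forall y x1 x2,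
  `|adjoint_fun y x1 x2| <= M * `|y| * `|x1| * `|x2|.
Proof.
have [M M0 hM] := trilinear_bounded_ge0; exists M => y x1 x2.
apply: dual_norm_le; first by rewrite !mulr_ge0.
move=> x3; apply: le_trans (le_dual_norm y _) _.
apply: le_trans (ler_wpM2l (dual_norm_ge0 y) (hM x1 x2 x3)) _.
by rewrite !mulrA [M * _]mulrC.
Qed.

Definition adjoint : bounded_trilinear (dual Y) X1 X2 (dual X3) :=
  BoundedTrilinear
    adjoint_linear1 adjoint_linear2 adjoint_linear3 adjoint_bounded.

End Adjoint.

Definition aron_berner (R : realType) (k : scalar_kind)
    (X1 X2 X3 Y : normedModType (scalars R k))
    (f : bounded_trilinear X1 X2 X3 Y) :
  bounded_trilinear (dual (dual X1)) (dual (dual X2)) (dual (dual X3))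
    (dual (dual Y)) :=
  adjoint (adjoint (adjoint (adjoint f))).

Variant perm3_spec : 'I_3 -> 'I_3 -> 'I_3 -> Prop :=
  | Perm012 : perm3_spec 0 1 2 | Perm021 : perm3_spec 0 2 1
  | Perm102 : perm3_spec 1 0 2 | Perm120 : perm3_spec 1 2 0
  | Perm201 : perm3_spec 2 0 1 | Perm210 : perm3_spec 2 1 0.

Lemma perm3P (s : 'S_3) : perm3_spec (s 0) (s 1) (s 2).
Proof.
have ordE (i : 'I_3) : [\/ i = 0, i = 1 | i = 2].
  by case: i => [[|[|[|//]]] ?]; [constructor 1|constructor 2|constructor 3];
    exact: val_inj.
have := (inj_eq (@perm_inj _ s) 0 1, inj_eq (@perm_inj _ s) 0 2,
  inj_eq (@perm_inj _ s) 1 2).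
by case: (ordE (s 0)) => ->; case: (ordE (s 1)) => ->; case: (ordE (s 2)) => ->;
  rewrite ?eqxx => -[[]] //; constructor.
Qed.

(** The symmetric group acts on trilinear maps whose three arguments lie in the
    same space; the argument positions 1, 2, 3 are the elements 0, 1, 2 of
    ['I_3].  [trilinear_permE] is the defining property of [f^s]. *)
Section Permutation.
Context (K : numFieldType) (X Y : normedModType K).
Context (s : 'S_3) (f : bounded_trilinear X X X Y).

Definition trilinear_perm_fun (y1 y2 y3 : X) : Y :=
  let y := tnth [tuple y1; y2; y3] in
  f (y (s^-1%g 0)) (y (s^-1%g 1)) (y (s^-1%g 2)).

Fact trilinear_perm1 y2 y3 : linear (fun y1 => trilinear_perm_fun y1 y2 y3).
Proof.
move=> a u v; rewrite /trilinear_perm_fun; case: perm3P;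
  by [exact: trilinear1|exact: trilinear2|exact: trilinear3].
Qed.

Fact trilinear_perm2 y1 y3 : linear (fun y2 => trilinear_perm_fun y1 y2 y3).
Proof.
move=> a u v; rewrite /trilinear_perm_fun; case: perm3P;
  by [exact: trilinear1|exact: trilinear2|exact: trilinear3].
Qed.

Fact trilinear_perm3 y1 y2 : linear (fun y3 => trilinear_perm_fun y1 y2 y3).
Proof.
move=> a u v; rewrite /trilinear_perm_fun; case: perm3P;
  by [exact: trilinear1|exact: trilinear2|exact: trilinear3].
Qed.

Fact trilinear_perm_bounded : exists M : K, forall y1 y2 y3,
  `|trilinear_perm_fun y1 y2 y3| <= M * `|y1| * `|y2| * `|y3|.
Proof.
have [M hM] := trilinear_bounded f; exists M => y1 y2 y3.
rewrite /trilinear_perm_fun; case: perm3P;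
  apply: le_trans (hM _ _ _) _; rewrite !(tnth_nth y1)/= le_eqVlt;
  apply/orP; left; apply/eqP; ring.
Qed.

Definition trilinear_perm : bounded_trilinear X X X Y :=
  BoundedTrilinear
    trilinear_perm1 trilinear_perm2 trilinear_perm3 trilinear_perm_bounded.

Lemma trilinear_permE (x : 'I_3 -> X) :
  trilinear_perm (x (s 0)) (x (s 1)) (x (s 2)) = f (x 0) (x 1) (x 2).
Proof.
have yE i : tnth [tuple x (s 0); x (s 1); x (s 2)] i = x (s i).
  by case: i => [[|[|[|//]]] ?]; rewrite (tnth_nth (x 0))/=;
    congr (x (s _)); exact: val_inj.
by rewrite /trilinear_perm/= /trilinear_perm_fun !yE !permKV.
Qed.

End Permutation.

Definition aron_berner_perm (R : realType) (k : scalar_kind)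
    (X Y : normedModType (scalars R k)) (s : 'S_3)
    (f : bounded_trilinear X X X Y) (x1 x2 x3 : dual (dual X)) :
    dual (dual Y) :=
  let x := tnth [tuple x1; x2; x3] in
  aron_berner (trilinear_perm s f) (x (s 0)) (x (s 1)) (x (s 2)).

Definition aron_berner_regular (R : realType) (k : scalar_kind)
    (X Y : normedModType (scalars R k)) (f : bounded_trilinear X X X Y) : Prop :=
  forall (s : 'S_3) (x1 x2 x3 : dual (dual X)),
    aron_berner_perm s f x1 x2 x3 = aron_berner f x1 x2 x3.

(* Main.v *)
From HB Require Import structures.
Require Import Defs.
From mathcomp Require Import all_boot all_order all_algebra fingroup perm.
From mathcomp Require Import all_classical all_reals all_analysis.
From mathcomp Require Import complex ring.

(** Unfolding the four adjoints, the Aron--Berner extension of [f] at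
    [(a, b, c)] and [y] is the iterated evaluation
      [a (x1 |-> b (x2 |-> c (x3 |-> y (f x1 x2 x3))))],
    and permuting the arguments of [f] permutes the order of evaluation.  Since
    adjacent transpositions generate the symmetric group, it suffices to
    exchange [a] with [b], or [b] with [c].  In either case the two evaluations
    act on a bounded bilinear form on [X]: [(x1, x2) |-> c (y (f x1 x2 _))],
    respectively [(x2, x3) |-> y (f x1 x2 x3)] with [x1] fixed.  So everything
    reduces to bilinear forms ([arens_swap]): for [l : X -> dual X] bounded and
    linear,
      [a (x |-> b (l x)) = b (y |-> a (x |-> l x y))].

    Regularity says that [l] is weakly compact, and then its second adjoint maps
    the bidual of [X] into [dual X] itself ([weakly_compact_bidual]): there is
    [p : dual X] such that [psi p = a (psi \o l)] for every [psi] in the bidual.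
    Taking for [psi] the evaluation at [y] identifies [p] as
    [y |-> a (x |-> l x y)]; taking [psi := b] gives the exchange.

    The point [p] is a weak cluster point of [l x] as [x] runs in the unit ball
    and tends to [a] in the weak-star sense; such [x] exist by Goldstine's
    theorem.  Goldstine's theorem is proved here without separation of convex
    sets: one looks at a near-minimizer, over the unit ball, of the sum of
    squares of the discrepancies [phi x - a phi], for finitely many [phi].  The
    first variation at such a point, paired with [norm a <= 1], forces the
    infimum to be zero. *)

Set Implicit Arguments.
Unset Strict Implicit.
Unset Printing Implicit Defensive.

Import Order.TTheory GRing.Theory Num.Theory.
Import numFieldNormedType.Exports.

Local Open Scope classical_set_scope.
Local Open Scope ring_scope.

(** * Real part and conjugation over both scalar fields *)

Section Scalars.
Context (R : realType) (k : scalar_kind).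
Local Notation K := (scalars R k).

(** The values are real scalars but stay in [K], where the norms live, so that
    they can be compared with norms. *)
Definition re_scalar : K -> K :=
  match k return scalars R k -> scalars R k with
  | RealScalars => id
  | ComplexScalars => fun z => (complex.Re z)%:C%C
  end.

Definition conj_scalar : K -> K :=
  match k return scalars R k -> scalars R k with
  | RealScalars => id
  | ComplexScalars => fun z => (z^*)%C
  end.

Lemma re_scalarD z w : re_scalar (z + w) = re_scalar z + re_scalar w.
Proof.
rewrite /re_scalar; case: k z w => //= -[a b] [c d] /=.
by apply/eqP; rewrite eq_complex /= addr0 !eqxx.
Qed.

Lemma re_scalar_real z : z \is Num.real -> re_scalar z = z.
Proof. by rewrite /re_scalar; case: k z => //= z; exact: RRe_real. Qed.

Lemma re_scalarZ t z : t \is Num.real -> re_scalar (t * z) = t * re_scalar z.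
Proof.
move=> treal; rewrite -[in LHS](re_scalar_real treal).
rewrite -[in RHS](re_scalar_real treal).
move: t z {treal}; rewrite /re_scalar; case: k => //= -[a b] [c d] /=.
by apply/eqP; rewrite eq_complex /= !mul0r !mulr0 !subr0 addr0 !eqxx.
Qed.

Lemma re_scalar_le z : re_scalar z <= `|z|.
Proof.
rewrite /re_scalar; case: k z => /= z; first exact: ler_norm.
by apply: le_trans (normc_ge_Re z); rewrite lecR ler_norm.
Qed.

Lemma conj_scalarM z : conj_scalar z * z = `|z| ^+ 2.
Proof.
rewrite /conj_scalar; case: k z => /= z.
  by rewrite -normrX ger0_norm ?sqr_ge0 ?expr2.
by rewrite normCKC.
Qed.

Lemma sqr_normD_scalar z w :
  `|z + w| ^+ 2 = `|z| ^+ 2 + re_scalar (conj_scalar z * w) *+ 2 + `|w| ^+ 2.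
Proof.
rewrite -!conj_scalarM.
rewrite /re_scalar /conj_scalar; case: k z w => /= [z w|[a b] [c d]].
  by ring.
apply/eqP; rewrite eq_complex /=; apply/andP; split; apply/eqP; ring.
Qed.

End Scalars.

(** * Goldstine's theorem *)

Section Goldstine.
Context (R : realType) (k : scalar_kind).
Local Notation K := (scalars R k).

(** The order of [K] may be partial and [K] need not be a [realType], so the
    infimum is obtained as the supremum of the nonnegative lower bounds. *)
Lemma approximate_minimizer (T : Type) (D : set T) (q : T -> K) :
  D !=set0 -> (forall x, 0 <= q x) ->
  exists d : K, [/\ 0 <= d, forall x, D x -> d <= q x &
    forall e, 0 < e -> exists2 x, D x & q x < d + e].
Proof.
move=> [x0 Dx0] q0.
pose L := [set m : K | 0 <= m /\ forall x, D x -> m <= q x].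
have L0 : L 0 by split.
have [d [/ubP dub /lbP dlub]] : supremums L !=set0.
  apply: (@scalars_supremums R k L (q x0)); first by exists 0.
    by move=> m [].
  by apply/ubP => m [_]; apply.
exists d; split; first exact: dub.
  by move=> x Dx; apply: dlub; apply/ubP => m [_]; apply.
move=> e e0; apply: contrapT => noD.
have : L (d + e).
  split; first by rewrite addr_ge0 ?(ltW e0) ?dub.
  move=> x Dx; rewrite real_leNgt ?ger0_real ?addr_ge0 ?(ltW e0) ?dub//.
  by apply/negP => qx; apply: noD; exists x.
by move/dub; rewrite gerDl => /(lt_le_trans e0); rewrite ltxx.
Qed.

Context (X : normedModType K).

Lemma dual_sumE (I : Type) (s : seq I) (F : I -> dual X) x :
  (\sum_(i <- s) F i) x = \sum_(i <- s) F i x.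
Proof. by elim/big_rec2: _ => //= i u v _ <-. Qed.

Lemma scalar_rotate (z : K) : exists2 u : K, `|u| <= 1 & u * z = - `|z|.
Proof.
have [->|z0] := eqVneq z 0; first by exists 0; rewrite ?normr0 ?mulr0 ?oppr0.
exists (- `|z| / z); last by rewrite divfK.
by rewrite normrM normrN normr_id normfV divff// normr_eq0.
Qed.

(** The unit ball is weak-star dense in the unit ball of the bidual; the finite
    family [s] may be rescaled, so the tolerance 1 is as good as any other.
    If the infimum [d] of the discrepancy [q] were positive, then at a
    near-minimizer [x] the functional [psi], the gradient of [q], would nearly
    satisfy [`|psi z| <= - Re (psi x)] on the unit ball.  As [`|a| <= 1], also
    [`|a psi|] is nearly at most [- Re (psi x)], whereas
    [Re (psi x - a psi) = q x >= d]. *)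
Lemma goldstine (a : dual (dual X)) (s : seq (dual X)) : `|a| <= 1 ->
  exists2 x : X, `|x| <= 1 & forall phi, phi \in s -> `|phi x - a phi| < 1.
Proof.
move=> a1.
pose q (x : X) : K := \sum_(phi <- s) `|phi x - a phi| ^+ 2.
have q0 x : 0 <= q x by apply: sumr_ge0 => phi _; rewrite exprn_ge0.
have [||d [d0 dle dlt]] := @approximate_minimizer X [set x | `|x| <= 1] q.
- by exists 0; rewrite /= normr0.
- by [].
have [dE|dN0] := eqVneq d 0.
  have [x /= x1 qx] := dlt 1 ltr01; exists x => // phi phis.
  rewrite -(@expr_lt1 _ 2)//; apply: le_lt_trans (_ : q x < 1).
    rewrite /q (perm_big _ (perm_to_rem phis)) big_cons lerDl.
    by apply: sumr_ge0 => psi _; rewrite exprn_ge0.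
  by rewrite -[ltRHS]add0r -[X in X + _]dE.
have {d0 dN0} d0 : 0 < d by rewrite lt_def dN0.
exfalso.
pose M : K := \sum_(phi <- s) (`|phi| *+ 2) ^+ 2.
have M0 : 0 <= M by apply: sumr_ge0 => phi _; rewrite exprn_ge0 ?mulrn_wge0.
(* a step size for which the second order term is dominated: [t * M < d] *)
have Md0 : 0 < M + d by rewrite ltr_wpDl.
have [t [t0 t1 tE]] : exists t, [/\ 0 < t, t <= 1 & t * (M + d) = d].
  exists (d / (M + d)); rewrite divr_gt0//.
  by rewrite ler_pdivrMr// mul1r lerDr M0 divfK// gt_eqF.
have t_ge0 := ltW t0.
have tr : t \is Num.real by exact: gtr0_real.
have [x /= x1 qx] := dlt (t * d) (mulr_gt0 t0 d0).
pose psi : dual X := \sum_(phi <- s) conj_scalar (phi x - a phi) *: phi.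
have psiE z : psi z = \sum_(phi <- s) conj_scalar (phi x - a phi) * phi z.
  by rewrite /psi dual_sumE.
have apsi : a psi = \sum_(phi <- s) conj_scalar (phi x - a phi) * a phi.
  by rewrite /psi linear_sum; apply: eq_bigr => phi _; rewrite linearZ.
have re_sum (F : dual X -> K) : re_scalar (\sum_(phi <- s) F phi)
    = \sum_(phi <- s) re_scalar (F phi).
  apply: (big_morph (@re_scalar R k)); first exact: re_scalarD.
  by rewrite re_scalar_real.
have qE : q x = re_scalar (psi x - a psi).
  rewrite psiE apsi -sumrB re_sum; apply: eq_bigr => phi _.
  by rewrite -mulrBr conj_scalarM re_scalar_real// ger0_real// exprn_ge0.
(* minimality tested along the segment from [x] to [z], which stays in the
   ball *)
have variation z : `|z| <= 1 ->
    d <= q x + t * re_scalar (psi z - psi x) *+ 2 + t ^+ 2 * M.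
  move=> z1; apply: le_trans (dle (x + t *: (z - x)) _) _ => /=.
    rewrite scalerBr addrCA -[X in _ + (X - _)]scale1r -scalerBl addrC.
    rewrite (le_trans (ler_normD _ _))// !normrZ.
    rewrite !ger0_norm ?subr_ge0//.
    by rewrite -[leRHS](subrK t) lerD// ler_piMr ?subr_ge0.
  rewrite !psiE -sumrB re_sum mulr_sumr -sumrMnl mulr_sumr -!big_split /=.
  apply: ler_sum => phi _.
  rewrite linearD linearZ /= (addrAC (phi x)) sqr_normD_scalar.
  rewrite lerD//.
    rewrite lerD2l lerMn2r/= -mulrBr linearB -re_scalarZ//.
    by rewrite [t *: _]/(t * _) mulrCA.
  rewrite [t *: _]/(t * _) normrM exprMn (ger0_norm (ltW t0)).
  rewrite ler_wpM2l ?exprn_ge0 ?(ltW t0)//.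
  rewrite lerXn2r ?nnegrE ?mulrn_wge0//.
  apply: le_trans (le_dual_norm _ _) _.
  rewrite -[leRHS]mulr_natr ler_wpM2l ?dual_norm_ge0//.
  by rewrite (le_trans (ler_normB _ _))// -[2]/(1 + 1) lerD.
have t2 : 0 < t *+ 2 by rewrite mulrn_wgt0.
pose C := (q x - d + t ^+ 2 * M) / (t *+ 2) - re_scalar (psi x).
have psiC : `|psi| <= C.
  have [_ /lbP] := dual_norm_lub psi; apply; apply/ubP => _ [z /= z1 <-].
  (* rotating [z] turns the bound on [- Re (psi z)] into one on [`|psi z|] *)
  have [u u1 uz] := scalar_rotate (psi z).
  have := variation (u *: z).
  rewrite normrZ mulr_ile1// => /(_ isT).
  rewrite linearZ /= (_ : u *: psi z = - `|psi z| :> K); last exact: uz.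
  rewrite -opprD -mulN1r.
  rewrite re_scalarZ ?rpredN ?rpred1// mulN1r re_scalarD.
  rewrite (re_scalar_real (ger0_real _))// => h.
  rewrite /C lerBrDr ler_pdivlMr// mulrC.
  rewrite -subr_ge0; move: h; rewrite -subr_ge0; congr (is_true (0 <= _)); ring.
have apsiC : re_scalar (- a psi) <= C.
  apply: le_trans (re_scalar_le _) _; rewrite normrN.
  apply: le_trans (le_dual_norm a psi) _; apply: le_trans psiC.
  by rewrite ler_piMl.
(* from here [2 t d <= 2 t (q x) <= (q x - d) + t^2 M < t d + t^2 M <= 2 t d] *)
have : q x * (t *+ 2) <= q x - d + t ^+ 2 * M.
  rewrite -ler_pdivlMr// [leLHS]qE re_scalarD.
  by rewrite -lerBrDl (le_trans apsiC).
move=> /le_lt_trans/(_ (_ : _ < t * d + t ^+ 2 * M)); rewrite ltrD2r.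
rewrite ltrBlDl => /(_ qx).
rewrite mulrnAr mulrC -mulrnAr expr2 -mulrA -mulrDr ltr_pM2l// => qlt.
have : t * M <= d by rewrite -[leRHS]tE mulrDr lerDl mulr_ge0// ltW.
rewrite -(lerD2l d) => /(lt_le_trans qlt).
by rewrite -mulr2n ltrMn2r/= => /(le_lt_trans (dle x x1)); rewrite ltxx.
Qed.
End Goldstine.

(** * Weakly compact maps send the bidual into the target *)

Lemma dual_weak_continuous (K : numFieldType) (X : normedModType K)
    (psi : dual X) : continuous (psi : weak X -> K^o).
Proof.
move=> x; have evx := @initial_continuous _ _ (@dual_eval K X) x.
have prx := @proj_continuous (dual X) (fun=> K^o) psi (@dual_eval K X x).
exact: (cvg_comp _ _ evx prx).
Qed.

Section WeaklyCompact.
Context (R : realType) (k : scalar_kind).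
Local Notation K := (scalars R k).
Context (X Y : normedModType K).

(** The second adjoint of a weakly compact [T] takes its values in [Y]; the
    hypothesis on [r] expresses [r = psi \o T]. *)
Lemma weakly_compact_bidual (T : X -> Y) (a : dual (dual X)) :
  weakly_compact T ->
  exists p : Y, forall (psi : dual Y) (r : dual X),
    (forall x, r x = psi (T x)) -> psi p = a r.
Proof.
move=> Tc.
wlog a1 : a / `|a| <= 1.
  move=> IH; pose n : K := 1 + `|a|.
  have n0 : 0 < n by rewrite ltr_pwDl.
  have [|p pE] := IH (n^-1 *: a).
    rewrite normrZ normfV (ger0_norm (ltW n0)) ler_pdivrMl// mulr1.
    by rewrite lerDr.
  exists (n *: p) => psi r rE; rewrite linearZ /= (pE _ _ rE) /=.
  by rewrite scalerA mulfV ?gt_eqF// scale1r.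
(* the trace on the unit ball of the weak-star neighbourhoods of [a] *)
pose B (s : seq (dual X)) :=
  [set x : X | `|x| <= 1 /\ forall phi, phi \in s -> `|phi x - a phi| < 1].
pose F := filter_from setT B.
have FF : ProperFilter F.
  apply: filter_from_proper.
    apply: filter_from_filter; first by exists [::].
    move=> s1 s2 _ _; exists (s1 ++ s2) => // x [x1 xs].
    by split; split=> // phi phis; apply: xs; rewrite mem_cat phis ?orbT.
  by move=> s _; have [x x1 xs] := goldstine s a1; exists x.
have [C TC [Cc _]] := Tc.
have FC : (T @ F) C.
  by exists [::] => // x [x1 _]; apply: TC; exists x.
have [p [_ pcl]] := Cc _ (fmap_proper_filter T FF) FC.
exists p => psi r rE; apply/eqP; rewrite -subr_eq0; apply: contrapT => /negP v0.
pose e : K := `|psi p - a r| / 2.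
have e0 : 0 < e by rewrite divr_gt0// normr_gt0.
(* tolerance [e] for [r] is tolerance 1 for [e^-1 *: r] *)
have FA : (T @ F) [set y | `|psi y - a r| < e].
  exists [:: e^-1 *: r] => // x [_ /(_ _ (mem_head _ _))] /=.
  rewrite linearZ /= -rE -scalerBr normrZ normfV (gtr0_norm e0).
  by rewrite ltr_pdivrMl// mulr1.
have pe : nbhs (p : weak Y) [set y | `|psi p - psi y| < e].
  have := @dual_weak_continuous _ _ psi p _ (nbhsx_ballx (psi p : K^o) e e0).
  by [].
have [y [/= ya yp]] := pcl _ _ FA pe.
have := ltrD yp ya; rewrite -splitr => /(le_lt_trans (ler_normD _ _)).
by rewrite addrA subrK ltxx.
Qed.
End WeaklyCompact.

(** * Exchanging two evaluations *)

Section Arens.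
Context (R : realType) (k : scalar_kind).
Local Notation K := (scalars R k).
Context (X : normedModType K).

Lemma dual_point_linear (x : X) : linear (fun phi : dual X => phi x : K^o).
Proof. by []. Qed.

Lemma dual_point_bounded (x : X) :
  bounded_map (fun phi : dual X => phi x : K^o).
Proof. by exists `|x| => phi; rewrite mulrC; exact: le_dual_norm. Qed.

Definition dual_point (x : X) : dual (dual X) :=
  Dual (dual_point_linear x) (dual_point_bounded x).

(** Arens regularity of the bilinear form [(x, y) |-> l x y = r y x].  The maps
    [l], [r], [p], [q] are given by their values, so that the lemma applies
    directly to the nested adjoints of a trilinear map. *)
Lemma arens_swap (hX : regular_Banach X) (l r : X -> dual X)
    (a b : dual (dual X)) (p q : dual X) :
  (forall x y, l x y = r y x) -> bounded_map l ->
  (forall x, p x = b (l x)) -> (forall y, q y = a (r y)) ->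
  a p = b q.
Proof.
move=> lr lb pE qE.
have llin : linear l.
  by move=> c x y; apply: dual_ext => z /=; rewrite !lr linearP.
pose T : {linear X -> dual X} :=
  HB.pack l (GRing.isLinear.Build K X (dual X) *:%R l llin).
have [t tE] := weakly_compact_bidual a (hX T lb).
rewrite -(tE b p pE); congr (b _); apply: dual_ext => y.
by rewrite qE; apply: (tE (dual_point y)) => x; rewrite /= lr.
Qed.
End Arens.

(** * Permuting the arguments of a trilinear map *)

Section Swaps.
Context (R : realType) (k : scalar_kind).
Local Notation K := (scalars R k).

Lemma trilinear_ext (X1 X2 X3 Y : normedModType K)
    (f g : bounded_trilinear X1 X2 X3 Y) :
  (forall x1 x2 x3, f x1 x2 x3 = g x1 x2 x3) -> f = g.
Proof.
case: f g => f f1 f2 f3 fb [g g1 g2 g3 gb] /= fg.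
have {}fg : f = g by do 3 apply/funext => ?; exact: fg.
by subst g; congr BoundedTrilinear; exact: Prop_irrelevance.
Qed.

Context (X Y : normedModType K).
Implicit Type f : bounded_trilinear X X X Y.

Lemma swap12_bounded f : exists M : K, forall x1 x2 x3,
  `|f x2 x1 x3| <= M * `|x1| * `|x2| * `|x3|.
Proof.
have [M fM] := trilinear_bounded f; exists M => x1 x2 x3.
by rewrite (le_trans (fM _ _ _))// [M * _ * _]mulrAC.
Qed.

Definition swap12 f : bounded_trilinear X X X Y :=
  BoundedTrilinear (fun x2 x3 => trilinear2 f x2 x3)
    (fun x1 x3 => trilinear1 f x1 x3) (fun x1 x2 => trilinear3 f x2 x1)
    (swap12_bounded f).

Lemma swap23_bounded f : exists M : K, forall x1 x2 x3,
  `|f x1 x3 x2| <= M * `|x1| * `|x2| * `|x3|.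
Proof.
have [M fM] := trilinear_bounded f; exists M => x1 x2 x3.
by rewrite (le_trans (fM _ _ _))// [leLHS]mulrAC.
Qed.

Definition swap23 f : bounded_trilinear X X X Y :=
  BoundedTrilinear (fun x2 x3 => trilinear1 f x3 x2)
    (fun x1 x3 => trilinear3 f x1 x3) (fun x1 x2 => trilinear2 f x1 x2)
    (swap23_bounded f).

Context (hX : regular_Banach X).

(** The innermost evaluation, at [c], is common to both sides; what remains is
    the bilinear form [(x1, x2) |-> c (x3 |-> y (f x1 x2 x3))]. *)
Lemma aron_berner_swap12 f a b c :
  aron_berner (swap12 f) b a c = aron_berner f a b c.
Proof.
apply: dual_ext => y; apply/esym.
apply: (arens_swap (l := adjoint (adjoint f) c y)
  (r := adjoint (adjoint (swap12 f)) c y) hX) => //.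
  by move=> x1 x2; congr (c _); apply: dual_ext.
have [M fM] := trilinear_bounded (adjoint (adjoint f)).
by exists (M * `|c| * `|y|) => x; exact: fM.
Qed.

(** The outermost evaluation, at [a], is common to both sides, so [x1] may be
    fixed. *)
Lemma aron_berner_swap23 f a b c :
  aron_berner (swap23 f) a c b = aron_berner f a b c.
Proof.
apply: dual_ext => y; congr (a _); apply: dual_ext => x; apply/esym.
apply: (arens_swap (l := adjoint f y x) (r := adjoint (swap23 f) y x) hX) => //.
have [M fM] := trilinear_bounded (adjoint f).
by exists (M * `|y| * `|x|) => z; exact: fM.
Qed.

Lemma aron_berner_regular_trilinear f : aron_berner_regular f.
Proof.
move=> s a b c; rewrite /aron_berner_perm; set x := tnth _.
have -> : aron_berner f a b c = aron_berner f (x 0) (x 1) (x 2).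
  by rewrite /x !(tnth_nth a).
have sV i j : s i = j -> s^-1%g j = i by move=> <-; rewrite permK.
(* [g] is [f] rearranged by a word in the adjacent transpositions *)
suff [g -> gE] : exists2 g, trilinear_perm s f = g &
    aron_berner g (x (s 0)) (x (s 1)) (x (s 2)) =
    aron_berner f (x 0) (x 1) (x 2) by [].
move: (sV 0) (sV 1) (sV 2).
case: (perm3P s) => /(_ _ erefl) s0 /(_ _ erefl) s1 /(_ _ erefl) s2;
  [exists f|exists (swap23 f)|exists (swap12 f)|exists (swap23 (swap12 f))
  |exists (swap12 (swap23 f))|exists (swap12 (swap23 (swap12 f)))];
  rewrite ?aron_berner_swap12 ?aron_berner_swap23 ?aron_berner_swap12 //;
  apply: trilinear_ext => x1 x2 x3;
  by rewrite /= /trilinear_perm_fun s0 s1 s2 !(tnth_nth x1).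
Qed.
End Swaps.

Theorem corollary2p11 (R : realType) (k : scalar_kind)
    (X : completeNormedModType (scalars R k)) (hX : regular_Banach X)
    (f : bounded_trilinear X X X X) :
  aron_berner_regular f.
Proof. exact: aron_berner_regular_trilinear. Qed.
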